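(* Let $(M,\cdot,1,<)$ be an ordered non-associative monoid. Then the summability algebra $k((M^{>1}))=\{f\in k((M)):\operatorname{supp}f>1\}$ has evaluations.
   Context: $k$ is a fixed associative, commutative, unital $\mathbb{Q}$-algebra. An algebra is a $k$-module with a $k$-bilinear product (not assumed associative or unital). A non-associative monoid is a set $M$ with a binary law $\cdot$ and an element $1$ with $1\cdot m=m\cdot1=m$ for all $m$ (associativity not required). An ordered non-associative monoid is one together with a (strict) partial ordering $<$ such that for all $x,y,z\in M$, $x<y$ implies $zx<zy$ and $xz<yz$. A subset of $(M,<)$ is Noetherian if each of its non-empty subsets has a finite, non-zero number of minimal elements. $k((M))$ is the $k$-module of functions $f:M\to k$ whose support $\operatorname{supp}f=\{m:f(m)\neq0\}$ is Noetherian, with pointwise module operations and Cauchy product $(a\cdot b)(m)=\sum_{uv=m}a(u)b(v)$. A family $f:I\to k((M))$ is summable iff $\bigcup_{i\in I}\operatorname{supp}f(i)$ is Noetherian and for each $m\in M$ the set $\{i\in I:m\in\operatorname{supp}f(i)\}$ is finite; its sum is the pointwise sum. This makes $k((M))$ a summability algebra. The condition $\operatorname{supp}f>1$ means $m>1$ for all $m\in\operatorname{supp}f$; $k((M^{>1}))$ is a subalgebra of $k((M))$ closed under summation, with the restricted notion of summability. For a set $I$, $I^{(\star)}$ is the free non-associative monoid on $I$ (non-associative words, including the empty word $\varnothing$ as identity). $k\langle\!\langle I\rangle\!\rangle^{\mathrm{na}}$ is the module of all functions $P:I^{(\star)}\to k$ with product $(P\cdot Q)(w)=\sum_{(uv)=w}P(u)Q(v)$;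 a family $(P_j)_{j\in J}$ in it is summable iff for each word $w$ the set $\{j:P_j(w)\neq0\}$ is finite, with pointwise sum. $X_i$ is the indicator function of the word $i$, and $k\langle\!\langle I\rangle\!\rangle^{\mathrm{na}}_0=\{P:P(\varnothing)=0\}$. A $k$-linear map $\phi$ between such modules is strongly linear if for every summable $v:I\to V$, $\phi\circ v$ is summable with sum $\phi(\Sigma_Iv)$. A summability algebra $A$ has evaluations if for every set $I$ and every summable $a:I\to A$ there is a strongly linear morphism of algebras $\mathrm{ev}_a:k\langle\!\langle I\rangle\!\rangle^{\mathrm{na}}_0\to A$ with $\mathrm{ev}_a(X_i)=a(i)$ for all $i\in I$. *)

(* Defs.v *)
From HB Require Import structures.
From mathcomp Require Import all_boot all_order all_algebra.
From mathcomp Require Import all_classical.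

Set Implicit Arguments.
Unset Strict Implicit.
Unset Printing Implicit Defensive.

Import Order.TTheory GRing.Theory.

Local Open Scope classical_set_scope.
Local Open Scope ring_scope.

HB.mixin Record Lmodule_hasBilinearMul (k : pzRingType) A
    of GRing.Lmodule k A := {
  amul : A -> A -> A;
  amul_linearl : forall b : A, linear (amul^~ b);
  amul_linearr : forall a : A, linear (amul a)
}.

#[short(type="naAlgType")]
HB.structure Definition NaAlgebra (k : pzRingType) :=
  {A of GRing.Lmodule k A & Lmodule_hasBilinearMul k A}.

(* This is only the data on which [has_evaluations] depends; no closure property
   of summable families is required here.  [family_sum v] is meaningful only
   when [v] is summable. *)
HB.mixin Record Lmodule_hasSummation (k : pzRingType) V
    of GRing.Lmodule k V := {
  summable : forall I : Type, (I -> V) -> Prop;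
  family_sum : forall I : Type, (I -> V) -> V
}.

#[short(type="sumModType")]
HB.structure Definition SumModule (k : pzRingType) :=
  {V of GRing.Lmodule k V & Lmodule_hasSummation k V}.

#[short(type="sumAlgType")]
HB.structure Definition SumAlgebra (k : pzRingType) :=
  {A of NaAlgebra k A & Lmodule_hasSummation k A}.

Arguments summable {k s I} v.
Arguments family_sum {k s I} v.

Definition strongly_linear (k : pzRingType) (V W : sumModType k)
    (phi : V -> W) : Prop :=
  linear phi /\
  forall (I : Type) (v : I -> V), summable v ->
    summable (phi \o v) /\ family_sum (phi \o v) = phi (family_sum v).

Definition amul_morphism (k : pzRingType) (A B : naAlgType k)
    (phi : A -> B) : Prop :=
  forall a b : A, phi (amul a b) = amul (phi a) (phi b).

HB.mixin Record UMagma_isOrdered (d : Order.disp_t) M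
    of UMagma M & Order.POrder d M := {
  ltmul2l : forall z x y : M, (x < y)%O -> (z * x < z * y)%O%g;
  ltmul2r : forall z x y : M, (x < y)%O -> (x * z < y * z)%O%g
}.

#[short(type="orderedUMagmaType")]
HB.structure Definition OrderedUMagma (d : Order.disp_t) :=
  {M of UMagma M & Order.POrder d M & UMagma_isOrdered d M}.

Lemma infinite_inj_seq (T : Type) (A : set T) : infinite_set A ->
  exists x : nat -> T, (forall n, A (x n)) /\ injective x.
Proof.
move=> /infiniteP/card_leP[f].
exists (fun n => val (f (SigSub (mem_set (I : [set: nat] n))))); split.
  by move=> n; exact: set_valP.
move=> i j /val_inj e; have := @inj _ _ _ f _ _ _ _ e.
by rewrite !inE => /(_ I I) /(congr1 val).
Qed.

Section Noetherian.
Context (d : Order.disp_t) (T : porderType d).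
Implicit Types (S X Y : set T) (x : nat -> T).

Definition minimal_elements X : set T :=
  [set x | X x /\ forall y, X y -> ~ (y < x)%O].

Definition noetherian S : Prop :=
  forall X, X `<=` S -> X !=set0 ->
    finite_set (minimal_elements X) /\ minimal_elements X !=set0.

Lemma noetherian_sub X Y : X `<=` Y -> noetherian Y -> noetherian X.
Proof. by move=> XY nY Z ZX; apply: nY => z /ZX /XY. Qed.

Lemma noetherian0 : noetherian set0.
Proof. by move=> X X0 [x /X0]. Qed.

Lemma noetherian_below S X y : noetherian S -> X `<=` S -> X y ->
  exists2 x, minimal_elements X x & (x <= y)%O.
Proof.
move=> nS XS Xy; case: (nS [set z | X z /\ (z <= y)%O]).
- by move=> z [/XS].
- by exists y; split.
move=> _ [x [[Xx xy] xmin]]; exists x => //; split => // z Xz zx.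
by apply: (xmin z) => //; split => //; apply: le_trans xy; apply: ltW.
Qed.

Lemma noetherianU X Y : noetherian X -> noetherian Y -> noetherian (X `|` Y).
Proof.
move=> nX nY Z ZXY [z0 Zz0]; split.
  have fin (W : set T) : noetherian W ->
      finite_set (minimal_elements Z `&` W).
    move=> nW; case: (pselect ((Z `&` W) !=set0)) => [ne|e].
      have [f _] := nW (Z `&` W) (@subIsetr _ _ _) ne.
      apply: sub_finite_set f => z [[Zz zm] Wz]; split => //.
      by move=> y [Zy _]; exact: zm.
    apply: sub_finite_set (@finite_set0 T) => z [[Zz _] Wz].
    by apply: e; exists z.
  have := fin _ nX; have := fin _ nY => fY fX.
  apply: (@sub_finite_set _ _ ((minimal_elements Z `&` X) `|`
     (minimal_elements Z `&` Y))); last by rewrite finite_setU.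
  by move=> z mz; case: (ZXY z mz.1); [left|right].
have key (W W' : set T) w : noetherian W -> noetherian W' ->
    Z `<=` W `|` W' -> Z w -> W w -> minimal_elements Z !=set0.
  move=> nW nW' ZW Zw Ww.
  have [x [[Zx Wx] xmin] _] :=
    noetherian_below nW (@subIsetr _ Z W) (conj Zw Ww).
  case: (pselect (exists2 y, Z y & (y < x)%O)) => [[y Zy yx]|nex]; last first.
    by exists x; split => // y Zy yx; apply: nex; exists y.
  have sub : [set z | Z z /\ (z < x)%O] `<=` W'.
    move=> z [Zz zx]; case: (ZW z Zz) => // Wz.
    by case: (xmin z).
  have [u [[Zu ux] umin] _] := noetherian_below nW' sub (conj Zy yx).
  exists u; split => // z Zz zu; apply: (umin z) => //; split => //.
  exact: lt_trans ux.
case: (ZXY z0 Zz0) => h; first exact: (key X Y z0).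
by apply: (key Y X z0) => //; rewrite setUC.
Qed.

Lemma noetherian_infinite S x (J : set nat) : noetherian S ->
  (forall n, S (x n)) -> infinite_set J ->
  exists2 n, J n &
    infinite_set [set m | J m /\ (n < m)%N /\ (x n <= x m)%O].
Proof.
move=> nS Sx Jinf.
have XS : x @` J `<=` S by move=> _ [n _ <-].
have Xne : x @` J !=set0.
  by have [n Jn] := infinite_setN0 Jinf; exists (x n), n.
have [fin _] := nS _ XS Xne.
have [mu [[n Jn <-] _] muinf] : exists2 mu, minimal_elements (x @` J) mu &
    infinite_set [set m | J m /\ (mu <= x m)%O].
  apply: contrapT => none; apply: Jinf.
  apply: (@sub_finite_set _ _ (\bigcup_(mu in minimal_elements (x @` J))
           [set m | J m /\ (mu <= x m)%O])).
    move=> m Jm.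
    have [mu mum mule] := noetherian_below nS XS (imageP x Jm).
    by exists mu.
  apply: bigcup_finite => // mu mum; apply: contrapT => inf.
  by apply: none; exists mu.
exists n => // fin'; apply: muinf.
apply: (@sub_finite_set _ _ ([set m | J m /\ (n < m)%N /\ (x n <= x m)%O]
   `|` `I_n.+1)).
  move=> m [Jm le]; case: (ltnP n m) => nm; first by left.
  by right.
by rewrite finite_setU; split => //; exact: finite_II.
Qed.

Lemma noetherian_seq S : (forall x, (forall n, S (x n)) ->
  exists i j, (i < j)%N /\ (x i <= x j)%O) -> noetherian S.
Proof.
move=> good X XS [x0 Xx0]; split.
  apply: contrapT => /infinite_inj_seq[x [xX xinj]].
  have [i [j [ij xij]]] := good x (fun n => XS _ (xX n).1).
  have [_ /(_ (x i) (xX i).1) nlt] := xX j.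
  move: xij; rewrite le_eqVlt => /orP[/eqP/xinj e|//].
  by rewrite e ltnn in ij.
apply: contrapT => none.
have next (z : {z | X z}) : {y : {z | X z} | (sval y < sval z)%O}.
  case: z => z Xz; apply: cid; apply: contrapT => nex.
  apply: none; exists z; split => // y Xy yz.
  by apply: nex; exists (exist _ y Xy).
pose u n := iter n (fun z => sval (next z)) (exist _ x0 Xx0).
have dec : {homo (fun n => sval (u n)) : i j / (i < j)%N >-> (j < i)%O}.
  apply: homo_ltn => [y z t zy ty|n /=]; first exact: lt_trans ty zy.
  by case: (next (u n)).
have [i [j [ij le]]] := good _ (fun n => XS _ (svalP (u n))).
by have := le_lt_trans le (dec _ _ ij); rewrite ltxx.
Qed.

End Noetherian.

Lemma noetherian_pair d d' (T : porderType d) (T' : porderType d')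
    (A : set T) (B : set T') (a : nat -> T) (b : nat -> T') :
  noetherian A -> noetherian B ->
  (forall n, A (a n)) -> (forall n, B (b n)) ->
  exists i j, [/\ (i < j)%N, (a i <= a j)%O & (b i <= b j)%O].
Proof.
move=> nA nB Aa Bb.
have step (J : {J : set nat | infinite_set J}) : {n | sval J n /\
    infinite_set [set m | sval J m /\ (n < m)%N /\ (a n <= a m)%O]}.
  apply: cid; case: J => J Jinf.
  by have [n] := noetherian_infinite nA Aa Jinf; exists n.
pose next J : {J : set nat | infinite_set J} :=
  exist (fun J : set nat => infinite_set J) _ (svalP (step J)).2.
pose J l := iter l next (exist (fun J => infinite_set J) setT infinite_nat).
pose n l := sval (step (J l)).
have Jdec l l' : (l <= l')%N -> sval (J l') `<=` sval (J l).
  elim: l' => [|l' IH]; first by rewrite leqn0 => /eqP->.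
  by rewrite leq_eqVlt => /orP[/eqP->//|/IH sub] m [/sub].
have nJ l : sval (J l) (n l) by exact: (svalP (step (J l))).1.
have inc i j : (i < j)%N -> (n i < n j)%N /\ (a (n i) <= a (n j))%O.
  by move=> ij; have [_ ?] := Jdec _ _ ij _ (nJ j).
have [i _ inf] := noetherian_infinite nB (fun l => Bb (n l)) infinite_nat.
have [j [_ [ij bij]]] := infinite_setN0 inf.
by exists (n i), (n j); have [? ?] := inc _ _ ij.
Qed.

Section OrderedUMagmaTheory.
Context (d : Order.disp_t) (M : orderedUMagmaType d).
Implicit Types (A B : set M) (x y z t : M).

Lemma lemul2 x y z t : (x <= y)%O -> (z <= t)%O -> (x * z <= y * t)%O%g.
Proof.
rewrite le_eqVlt => /orP[/eqP->|xy]; rewrite le_eqVlt => /orP[/eqP->|zt] //.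
- exact/ltW/ltmul2l.
- exact/ltW/ltmul2r.
- by apply/ltW; apply: lt_trans (ltmul2r _ _ _ xy) (ltmul2l _ _ _ zt).
Qed.

Lemma lemul2_eq x y z t : (x <= y)%O -> (z <= t)%O ->
  (x * z = y * t)%g -> x = y /\ z = t.
Proof.
move=> xy zt e; suff [? ?] : ~ (x < y)%O /\ ~ (z < t)%O.
  by move: xy zt; rewrite !le_eqVlt => /orP[/eqP|//] ? /orP[/eqP|//].
split=> lt.
  by have := lt_le_trans (ltmul2r z _ _ lt) (lemul2 (lexx y) zt);
    rewrite e ltxx.
by have := lt_le_trans (ltmul2l x _ _ lt) (lemul2 xy (lexx t));
  rewrite e ltxx.
Qed.

Lemma noetherianM A B : noetherian A -> noetherian B ->
  noetherian [set (u * v)%g | u in A & v in B].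
Proof.
move=> nA nB; apply: noetherian_seq => x xAB.
have /all_sig [p pP] : forall n,
    {p : M * M | [/\ A p.1, B p.2 & (p.1 * p.2)%g = x n]}.
  by move=> n; apply: cid; have [u Au [v Bv e]] := xAB n; exists (u, v).
have [|n|i [j [ij le1 le2]]] :=
  @noetherian_pair _ _ _ _ _ _ (fun n => (p n).1) (fun n => (p n).2) nA nB.
- by move=> n; case: (pP n).
- by case: (pP n).
exists i, j; split => //.
by case: (pP i) => _ _ <-; case: (pP j) => _ _ <-; exact: lemul2.
Qed.

Lemma noetherian_finite_decomp A B (m : M) : noetherian A -> noetherian B ->
  finite_set [set p : M * M | (p.1 * p.2)%g = m /\ A p.1 /\ B p.2].
Proof.
move=> nA nB; apply: contrapT => /infinite_inj_seq[p [pP pinj]].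
have [|n|i [j [ij le1 le2]]] :=
  @noetherian_pair _ _ _ _ _ _ (fun n => (p n).1) (fun n => (p n).2) nA nB.
- by move=> n; have [_ []] := pP n.
- by have [_ []] := pP n.
have e : ((p i).1 * (p i).2 = (p j).1 * (p j).2)%g.
  by rewrite (pP i).1 (pP j).1.
have [e1 e2] := lemul2_eq le1 le2 e.
have /pinj e' : p i = p j.
  by rewrite (surjective_pairing (p i)) e1 e2 -surjective_pairing.
by rewrite e' ltnn in ij.
Qed.

End OrderedUMagmaTheory.

Section FiniteSupportSums.
Context (k : comPzRingType).

Lemma fsum_linear (T : choiceType) (P : set T) (f g : T -> k) (c : k) :
  finite_set (P `&` [set x | f x != 0]) ->
  finite_set (P `&` [set x | g x != 0]) ->
  \sum_(x \in P) (c * f x + g x) =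
  c * (\sum_(x \in P) f x) + \sum_(x \in P) g x.
Proof.
move=> ff fg; pose X := P `&` [set x | f x != 0] `|` P `&` [set x | g x != 0].
have fX : finite_set X by rewrite finite_setU.
have XP : X `<=` P by move=> x [] [].
have off x : (P `\` X) x -> f x = 0 /\ g x = 0.
  move=> [Px nX]; split; apply/eqP; apply: contrapT => /negP h; apply: nX.
  - by left.
  - by right.
have wid (h : T -> k) : (forall x, (P `\` X) x -> h x = 0) ->
    \sum_(x \in P) h x = \sum_(x \in X) h x.
  by move=> h0; symmetry; apply: fsbig_widen => // x /h0.
rewrite !wid; first by rewrite !fsbig_finite//= big_split/= mulr_sumr.
all: by move=> x /off[f0 g0]; rewrite ?g0 ?f0 ?mulr0 ?addr0.
Qed.

End FiniteSupportSums.

Section CauchyProduct.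
Context (k : comPzRingType).

Definition supp (T : Type) (f : T -> k) : set T := [set m | f m != 0].

(* [\sum_(p \in P) F p] is the sum of [F] over the elements of [P] where it is
   nonzero, provided that there are finitely many of them. *)
Definition cauchy (M : umagmaType) (a b : M -> k) (m : M) : k :=
  \sum_(p \in [set p : M * M | (p.1 * p.2)%g = m]) a p.1 * b p.2.

Definition finite_decomp (M : umagmaType) (a b : M -> k) : Prop :=
  forall m : M,
    finite_set [set p : M * M | (p.1 * p.2)%g = m /\ supp a p.1 /\ supp b p.2].

Variable M : umagmaType.
Implicit Types (a b : M -> k^o) (c : k).

Let mul_supp a b m : finite_decomp a b ->
  finite_set ([set p : M * M | (p.1 * p.2)%g = m] `&`
              [set p | a p.1 * b p.2 != 0 :> k]).
Proof.
move=> /(_ m); apply: sub_finite_set => p [pm ab0]; split => //; split.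
- by apply: contra_neq ab0 => ->; rewrite mul0r.
- by apply: contra_neq ab0 => ->; rewrite mulr0.
Qed.

Lemma cauchy_linearl c a a' b : finite_decomp a b -> finite_decomp a' b ->
  cauchy (c *: a + a') b = c *: (cauchy a b : M -> k^o) + cauchy a' b.
Proof.
move=> fa fa'; apply/funext => m; rewrite /cauchy.
rewrite -[RHS](fsum_linear c (mul_supp m fa) (mul_supp m fa')).
apply: eq_fsbigr => p _; rewrite mulrA -mulrDl; by [].
Qed.

Lemma cauchy_linearr c a b b' : finite_decomp a b -> finite_decomp a b' ->
  cauchy a (c *: b + b') = c *: (cauchy a b : M -> k^o) + cauchy a b'.
Proof.
move=> fb fb'; apply/funext => m; rewrite /cauchy.
rewrite -[RHS](fsum_linear c (mul_supp m fb) (mul_supp m fb')).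
apply: eq_fsbigr => p _; rewrite mulrCA -mulrDr; by [].
Qed.

Lemma supp_cauchy a b :
  supp (cauchy a b) `<=` [set (u * v)%g | u in supp a & v in supp b].
Proof.
move=> m mab.
have [p pm p0] : exists2 p : M * M, (p.1 * p.2)%g = m & a p.1 * b p.2 != 0.
  exact: (@fsbigN1 k 0 _ unit _ _ (fun _ p => a p.1 * b p.2) tt mab).
exists p.1; first by apply: contra_neq p0 => ->; rewrite mul0r.
by exists p.2 => //; apply: contra_neq p0 => ->; rewrite mulr0.
Qed.

End CauchyProduct.

(* Pointwise sum of a family of functions; [{classic I}] is [I] itself with a
   choice operator, needed to index the sum. *)
Definition pointwise_sum (k : comPzRingType) (I T : Type) (v : I -> T -> k)
    (m : T) : k :=
  \sum_(i \in [set: {classic I}]) v i m.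

Lemma supp_pointwise_sum (k : comPzRingType) (I T : Type) (v : I -> T -> k) :
  supp (pointwise_sum v) `<=` \bigcup_i supp (v i).
Proof.
move=> m h.
have [i _ ?] := @fsbigN1 k 0 _ unit {classic I} _ (fun _ i => v i m) tt h.
by exists i.
Qed.

Section HahnSeries.
Context (k : comPzRingType) (d : Order.disp_t) (M : orderedUMagmaType d).

Definition hahn_pred : {pred M -> k^o} := fun f => `[< noetherian (supp f) >].

Record hahn := Hahn { hahn_fun :> M -> k^o; _ : hahn_fun \in hahn_pred }.

HB.instance Definition _ := [isSub for hahn_fun].
HB.instance Definition _ := [Choice of hahn by <:].

Lemma hahn_submod_closed : submod_closed hahn_pred.
Proof.
split=> [|c f g].
  apply/asboolP; apply: noetherian_sub (@noetherian0 _ M) => m.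
  by rewrite /supp /= eqxx.
rewrite !unfold_in => /asboolP nf /asboolP ng; apply/asboolP.
apply: noetherian_sub (noetherianU nf ng) => m h.
apply: contrapT => /not_orP[/negP/negPn/eqP f0 /negP/negPn/eqP g0].
have : c * f m + g m != 0 by [].
by rewrite f0 g0 mulr0 addr0 eqxx.
Qed.

HB.instance Definition _ :=
  GRing.SubChoice_isSubLmodule.Build _ _ _ hahn hahn_submod_closed.

Implicit Types f g : hahn.

Lemma hahn_noetherian f : noetherian (supp f).
Proof. by case: f => f /= /asboolP. Qed.

Lemma hahn_finite_decomp f g : finite_decomp f g.
Proof.
by move=> m; apply: noetherian_finite_decomp; exact: hahn_noetherian.
Qed.

Lemma hahn_mul_closed f g : (cauchy f g : M -> k^o) \in hahn_pred.
Proof.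
apply/asboolP; apply: noetherian_sub (@supp_cauchy _ _ _ _) _.
by apply: noetherianM; exact: hahn_noetherian.
Qed.

Definition hahn_mul f g : hahn := Hahn (hahn_mul_closed f g).

Lemma hahn_mul_linearl g : linear (hahn_mul^~ g).
Proof.
move=> c f f'; apply/val_inj; apply: cauchy_linearl;
  exact: hahn_finite_decomp.
Qed.

Lemma hahn_mul_linearr f : linear (hahn_mul f).
Proof.
move=> c g g'; apply/val_inj; apply: cauchy_linearr;
  exact: hahn_finite_decomp.
Qed.

HB.instance Definition _ := Lmodule_hasBilinearMul.Build k hahn
  hahn_mul_linearl hahn_mul_linearr.

Definition hahn_summable (I : Type) (v : I -> hahn) : Prop :=
  noetherian (\bigcup_i supp (v i)) /\
  forall m : M, finite_set [set i | supp (v i) m].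

(* The pointwise sum lies in [hahn] when [v] is summable: [hahn_sumE]. *)
Definition hahn_sum (I : Type) (v : I -> hahn) : hahn :=
  insubd 0 (pointwise_sum v : M -> k^o).

Lemma hahn_sumE (I : Type) (v : I -> hahn) :
  hahn_summable v -> hahn_sum v = pointwise_sum v :> (M -> k).
Proof.
move=> [nv _]; rewrite /hahn_sum -[LHS]/(val _) insubdK//; apply/asboolP.
exact: noetherian_sub (@supp_pointwise_sum _ _ _ _) nv.
Qed.

HB.instance Definition _ := Lmodule_hasSummation.Build k hahn
  hahn_summable hahn_sum.

End HahnSeries.

Section HahnSeriesGt1.
Context (k : comPzRingType) (d : Order.disp_t) (M : orderedUMagmaType d).

Definition hahn_gt1_pred : {pred hahn k M} :=
  fun f => `[< forall m, supp f m -> (1%g < m)%O >].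

Record hahn_gt1 :=
  HahnGt1 { hahn_gt1_val :> hahn k M; _ : hahn_gt1_val \in hahn_gt1_pred }.

HB.instance Definition _ := [isSub for hahn_gt1_val].
HB.instance Definition _ := [Choice of hahn_gt1 by <:].

Lemma hahn_gt1_submod_closed : submod_closed hahn_gt1_pred.
Proof.
split=> [|c f g].
  by apply/asboolP => m; rewrite /supp /= eqxx.
rewrite !unfold_in => /asboolP nf /asboolP ng; apply/asboolP => m h.
apply: contrapT => nm.
have f0 : f m = 0 by apply/eqP; apply: contrapT => /negP /nf.
have g0 : g m = 0 by apply/eqP; apply: contrapT => /negP /ng.
have : c * f m + g m != 0 by [].
by rewrite f0 g0 mulr0 addr0 eqxx.
Qed.

HB.instance Definition _ :=
  GRing.SubChoice_isSubLmodule.Build _ _ _ hahn_gt1 hahn_gt1_submod_closed.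

Implicit Types f g : hahn_gt1.

Lemma hahn_gt1_supp f m : supp f m -> (1%g < m)%O.
Proof. by case: f => f /= /asboolP; apply. Qed.

Lemma hahn_gt1_mul_closed f g : amul (val f) (val g) \in hahn_gt1_pred.
Proof.
apply/asboolP => m /supp_cauchy [u /hahn_gt1_supp u1 [v /hahn_gt1_supp v1 <-]].
by apply: lt_trans u1 _; rewrite -{1}[u]mulg1; exact: ltmul2l.
Qed.

Definition hahn_gt1_mul f g : hahn_gt1 := HahnGt1 (hahn_gt1_mul_closed f g).

Lemma hahn_gt1_mul_linearl g : linear (hahn_gt1_mul^~ g).
Proof. by move=> c f f'; apply/val_inj; exact: amul_linearl. Qed.

Lemma hahn_gt1_mul_linearr f : linear (hahn_gt1_mul f).
Proof. by move=> c g g'; apply/val_inj; exact: amul_linearr. Qed.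

HB.instance Definition _ := Lmodule_hasBilinearMul.Build k hahn_gt1
  hahn_gt1_mul_linearl hahn_gt1_mul_linearr.

Definition hahn_gt1_summable (I : Type) (v : I -> hahn_gt1) : Prop :=
  summable (fun i => val (v i)).

(* The sum lies in [hahn_gt1] when [v] is summable: [hahn_gt1_sumE]. *)
Definition hahn_gt1_sum (I : Type) (v : I -> hahn_gt1) : hahn_gt1 :=
  insubd 0 (family_sum (fun i => val (v i))).

Lemma hahn_gt1_sumE (I : Type) (v : I -> hahn_gt1) :
  hahn_gt1_summable v ->
  val (hahn_gt1_sum v) = family_sum (fun i => val (v i)).
Proof.
move=> sv; rewrite /hahn_gt1_sum insubdK//; apply/asboolP => m.
have -> : family_sum (fun i => val (v i)) = pointwise_sum v :> (M -> k).
  exact: hahn_sumE sv.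
by move=> h; have [i _] := supp_pointwise_sum h; exact: hahn_gt1_supp.
Qed.

HB.instance Definition _ := Lmodule_hasSummation.Build k hahn_gt1
  hahn_gt1_summable hahn_gt1_sum.

End HahnSeriesGt1.

Section NaWords.
Variable I : Type.

Inductive na_tree : Type :=
| NaLeaf of I
| NaNode of na_tree & na_tree.

(* [None] is the empty word. *)
Definition na_word : Type := option na_tree.

HB.instance Definition _ := gen_eqMixin na_word.
HB.instance Definition _ := gen_choiceMixin na_word.

Definition na_concat (u v : na_word) : na_word :=
  match u, v with
  | None, _ => v
  | _, None => u
  | Some s, Some t => Some (NaNode s t)
  end.

Lemma na_concat0w : left_id None na_concat.
Proof. by []. Qed.

Lemma na_concatw0 : right_id None na_concat.
Proof. by case. Qed.

HB.instance Definition _ := hasMul.Build na_word na_concat.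
HB.instance Definition _ :=
  Magma_isUMagma.Build na_word na_concat0w na_concatw0.

Definition na_letter (i : I) : na_word := Some (NaLeaf i).

Lemma na_word_decomp (w : na_word) :
  finite_set [set p : na_word * na_word | (p.1 * p.2)%g = w].
Proof.
pose q (w : na_word) : na_word * na_word :=
  if w is Some (NaNode s t) then (Some s, Some t) else (None, w).
apply: (@sub_finite_set _ _ [set (None, w); (w, None); q w]); last first.
  by rewrite !finite_setU; do !split; exact: finite_set1.
move=> [[s|] [t|]] /= <-.
- by right.
- by left; right.
- by left; left.
- by left; left.
Qed.

End NaWords.

Section NaSeries.
Context (k : comPzRingType) (I : Type).

Definition na_series : Type := na_word I -> k^o.

HB.instance Definition _ := GRing.Lmodule.copy na_series (na_word I -> k^o).

Lemma na_series_finite_decomp (P Q : na_series) : finite_decomp P Q.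
Proof. by move=> w; apply: sub_finite_set (na_word_decomp w) => p []. Qed.

Definition na_series_mul (P Q : na_series) : na_series := cauchy P Q.

Lemma na_series_mul_linearl Q : linear (na_series_mul^~ Q).
Proof.
by move=> c P P'; apply: cauchy_linearl; exact: na_series_finite_decomp.
Qed.

Lemma na_series_mul_linearr P : linear (na_series_mul P).
Proof.
by move=> c Q Q'; apply: cauchy_linearr; exact: na_series_finite_decomp.
Qed.

HB.instance Definition _ := Lmodule_hasBilinearMul.Build k na_series
  na_series_mul_linearl na_series_mul_linearr.

Definition na_series_summable (J : Type) (P : J -> na_series) : Prop :=
  forall w : na_word I, finite_set [set j | P j w != 0].

Definition na_series_sum (J : Type) (P : J -> na_series) : na_series :=
  pointwise_sum P.

HB.instance Definition _ := Lmodule_hasSummation.Build k na_series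
  na_series_summable na_series_sum.

Definition na_X (i : I) : na_series := fun w => (w == na_letter i)%:R.

Definition na_series0_pred : {pred na_series} := fun P => P None == 0.

Record na_series0 := NaSeries0 {
  na_series0_val :> na_series; _ : na_series0_val \in na_series0_pred }.

HB.instance Definition _ := [isSub for na_series0_val].
HB.instance Definition _ := [Choice of na_series0 by <:].

Lemma na_series0_submod_closed : submod_closed na_series0_pred.
Proof.
split=> [|c f g]; first exact/eqP.
rewrite !unfold_in => /eqP f0 /eqP g0; apply/eqP.
by rewrite -[LHS]/(c * f None + g None) f0 g0 mulr0 addr0.
Qed.

HB.instance Definition _ :=
  GRing.SubChoice_isSubLmodule.Build _ _ _ na_series0 na_series0_submod_closed.

Implicit Types P Q : na_series0.

Lemma na_series0_mul_closed P Q : amul (val P) (val Q) \in na_series0_pred.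
Proof.
apply/eqP; apply: contrapT => /eqP /supp_cauchy[[s|] Ps [[t|] //]].
by case: P Ps => P /= /eqP P0; rewrite /supp /= P0 eqxx.
Qed.

Definition na_series0_mul P Q : na_series0 :=
  NaSeries0 (na_series0_mul_closed P Q).

Lemma na_series0_mul_linearl Q : linear (na_series0_mul^~ Q).
Proof. by move=> c P P'; apply/val_inj; exact: amul_linearl. Qed.

Lemma na_series0_mul_linearr P : linear (na_series0_mul P).
Proof. by move=> c Q Q'; apply/val_inj; exact: amul_linearr. Qed.

HB.instance Definition _ := Lmodule_hasBilinearMul.Build k na_series0
  na_series0_mul_linearl na_series0_mul_linearr.

Lemma na_series0_sum_closed (J : Type) (P : J -> na_series0) :
  family_sum (fun j => val (P j)) \in na_series0_pred.
Proof.
apply/eqP; apply: contrapT => /eqP h; have [j _] := supp_pointwise_sum h.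
by case: (P j) => Q /= /eqP Q0; rewrite /supp /= Q0 eqxx.
Qed.

Definition na_series0_summable (J : Type) (P : J -> na_series0) : Prop :=
  summable (fun j => val (P j)).

Definition na_series0_sum (J : Type) (P : J -> na_series0) : na_series0 :=
  NaSeries0 (na_series0_sum_closed P).

HB.instance Definition _ := Lmodule_hasSummation.Build k na_series0
  na_series0_summable na_series0_sum.

Lemma na_X_closed (i : I) : na_X i \in na_series0_pred.
Proof. by apply/eqP; rewrite /na_X; case: (_ =P na_letter i). Qed.

Definition na_X0 (i : I) : na_series0 := NaSeries0 (na_X_closed i).

End NaSeries.

Definition has_evaluations (k : comPzRingType) (A : sumAlgType k) : Prop :=
  forall (I : Type) (a : I -> A), summable a ->
    exists ev : na_series0 k I -> A,
      [/\ strongly_linear ev, amul_morphism ev &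
          forall i : I, ev (na_X0 k i) = a i].

(* Main.v *)
(* A non-associative word in the index set I is a binary tree with leaves in I;
   let a^t denote the product of the a(i) along the tree t.  The evaluation is
   P |-> sum_t P(t) a^t, so the point is that the family (a^t)_t is summable,
   a statement of Higman-Kruskal type.  Order the pairs (j, m), where j is an
   index and m : M, by comparing the second components strictly: a family v is
   summable if and only if its graph {(j, m) | m in supp v(j)} is Noetherian for
   this order.  If the graph of t |-> a^t were not Noetherian, take a minimal
   bad sequence in it.  The pairs coming from the subtrees of its terms lie below
   these terms, because all values are > 1, and hence form a Noetherian set;
   thus the sequence ranges over leaves, which form a Noetherian set as a is
   summable, and products of elements of a Noetherian set, a contradiction. *)
From HB Require Import structures.
Require Import Defs.
From mathcomp Require Import all_boot all_order all_algebra all_classical.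
Import GRing.Theory.

Set Implicit Arguments.
Unset Strict Implicit.
Unset Printing Implicit Defensive.

Import Order.TTheory.

Local Open Scope classical_set_scope.
Local Open Scope ring_scope.

(** * Bad sequences and minimal bad sequences *)

Section NoetherianSequences.
Context (d : Order.disp_t) (T : porderType d).
Implicit Types (S : set T) (x : nat -> T).

Lemma noetherian_good S x : noetherian S -> (forall n, S (x n)) ->
  exists i j, (i < j)%N /\ (x i <= x j)%O.
Proof.
move=> nS Sx; have [i [j [ij ? _]]] := noetherian_pair nS nS Sx Sx.
by exists i, j.
Qed.

Definition bad_seq S x : Prop :=
  (forall n, S (x n)) /\ forall i j, (i < j)%N -> ~ (x i <= x j)%O.

Lemma not_noetherian_bad S : ~ noetherian S -> exists x, bad_seq S x.
Proof.
move=> nS; apply: contrapT => nex; apply: nS; apply: noetherian_seq => x Sx.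
apply: contrapT => ng; apply: nex; exists x; split=> // i j ij le.
by apply: ng; exists i, j.
Qed.

(** Minimality refers to a measure in [nat], so a minimiser exists even if the order of [T] is not
    well-founded. *)
Lemma bad_seq_min S (mu : T -> nat) n x : bad_seq S x ->
  exists y, [/\ bad_seq S y, forall i, (i < n)%N -> y i = x i &
    forall z, bad_seq S z -> (forall i, (i < n)%N -> z i = x i) ->
      (mu (y n) <= mu (z n))%N].
Proof.
move=> bx; pose Q l := `[< exists z, [/\ bad_seq S z,
  forall i, (i < n)%N -> z i = x i & mu (z n) = l] >].
have exQ : exists l, Q l by exists (mu (x n)); apply/asboolP; exists x.
case: (ex_minnP exQ) => l /asboolP[y [By yx <-]] ymin.
by exists y; split=> // z Bz zx; apply: ymin; apply/asboolP; exists z.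
Qed.

(* Nash-Williams: [x n] has minimal measure among the possible [n]-th terms of
   bad sequences starting with [x 0], ..., [x n.-1].  A bad sequence in the set
   below could be grafted onto such an initial segment, against minimality. *)
Lemma minimal_bad_seq S (mu : T -> nat) : ~ noetherian S ->
  exists2 x, bad_seq S x &
    noetherian [set y | S y /\ exists2 n, (mu y < mu (x n))%N & (y <= x n)%O].
Proof.
move=> /not_noetherian_bad[x0 bx0].
pose step n (b : {x | bad_seq S x}) :=
  cid (bad_seq_min mu n (svalP b)).
pose next n b : {x | bad_seq S x} :=
  let: exist y (And3 By _ _) := step n b in exist _ y By.
have nextE n b i : (i < n)%N -> sval (next n b) i = sval b i.
  by rewrite /next; case: (step n b) => y [? yb _] /=; exact: yb.
have next_min n b z : bad_seq S z -> (forall i, (i < n)%N -> z i = sval b i) ->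
    (mu (sval (next n b) n) <= mu (z n))%N.
  by rewrite /next; case: (step n b) => y [? _ ymin] /=; exact: ymin.
(* Stages after [b n] keep its terms up to index [n], so the diagonal [x] below inherits badness and
   every minimality property. *)
pose b := fix b n := next n (if n is n'.+1 then b n' else exist _ x0 bx0).
have b_stable n m i : (i <= n)%N -> (n <= m)%N -> sval (b m) i = sval (b n) i.
  move=> le_in; elim: m => [|m IH]; first by rewrite leqn0 => /eqP->.
  rewrite leq_eqVlt => /orP[/eqP->//|]; rewrite ltnS => le_nm.
  by rewrite -(IH le_nm) /= nextE// ltnS (leq_trans le_in).
pose x n := sval (b n) n.
have xE n i : (i <= n)%N -> sval (b n) i = x i.
  by move=> le_in; rewrite (b_stable i).
have xmin n z : bad_seq S z -> (forall i, (i < n)%N -> z i = x i) ->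
    (mu (x n) <= mu (z n))%N.
  move=> bz zx; rewrite /x; case: n zx => [|n] zx; first exact: next_min.
  by apply: next_min => // i lt_in; rewrite zx// xE.
have bad_x : bad_seq S x.
  split=> [n|i j lt_ij]; first exact: (svalP (b n)).1.
  rewrite -(xE j i (ltnW lt_ij)); exact: (svalP (b j)).2.
exists x => //; apply: contrapT => /not_noetherian_bad[y [Dy bad_y]].
pose Q n := `[< exists l, (mu (y l) < mu (x n))%N /\ (y l <= x n)%O >].
have exQ : exists n, Q n.
  by have [_ [n ? ?]] := Dy 0; exists n; apply/asboolP; exists 0.
case: (ex_minnP exQ) => n /asboolP[l [mul lel]] nmin.
(* As [n] is the least index with some [y l] smaller and below [x n], the graft replaces [x n] by
   [y l] and continues along [y]. *)
pose z i := if (i < n)%N then x i else y (l + (i - n))%N.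
have bad_z : bad_seq S z.
  split=> [i|i j lt_ij].
    by rewrite /z; case: ifP => _; [exact: bad_x.1 | exact: (Dy _).1].
  rewrite /z; case: (ltnP j n) => [lt_jn|le_nj].
    by rewrite (ltn_trans lt_ij lt_jn); exact: bad_x.2.
  case: (ltnP i n) => [lt_in|le_ni]; last first.
    by apply: bad_y; rewrite ltn_add2l ltn_sub2r// (leq_ltn_trans le_ni).
  (* The tail term lies below some [x p], and [n <= p] by the choice of [n]; so [x i] below it would
     give [x i <= x p] with [i < p]. *)
  have [_ [p mup lep]] := Dy (l + (j - n))%N.
  have /(leq_trans lt_in) lt_ip : (n <= p)%N.
    by apply: nmin; apply/asboolP; eexists; split; [exact: mup|].
  by move=> /le_trans /(_ lep); exact: bad_x.2.
have zx i : (i < n)%N -> z i = x i by rewrite /z => ->.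
have := xmin n z bad_z zx.
by rewrite /z ltnn subnn addn0 leqNgt mul.
Qed.

End NoetherianSequences.

(** * Monotone images of Noetherian sets *)

Lemma noetherian_image2 d1 d2 d3 (T1 : porderType d1) (T2 : porderType d2)
    (T3 : porderType d3) (f : T1 -> T2 -> T3) (A : set T1) (B : set T2) :
  (forall x y z t, (x <= y)%O -> (z <= t)%O -> (f x z <= f y t)%O) ->
  noetherian A -> noetherian B ->
  noetherian [set f u v | u in A & v in B].
Proof.
move=> mf nA nB; apply: noetherian_seq => x xAB.
have /all_sig [p pP] : forall n,
    {p : T1 * T2 | [/\ A p.1, B p.2 & f p.1 p.2 = x n]}.
  by move=> n; apply: cid; have [u Au [v Bv e]] := xAB n; exists (u, v).
have [|n|i [j [ij le1 le2]]] :=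
  @noetherian_pair _ _ _ _ _ _ (fun n => (p n).1) (fun n => (p n).2) nA nB.
- by move=> n; case: (pP n).
- by case: (pP n).
exists i, j; split => //.
by case: (pP i) => _ _ <-; case: (pP j) => _ _ <-; exact: mf.
Qed.

Lemma noetherian_image d1 d2 (T1 : porderType d1) (T2 : porderType d2)
    (f : T1 -> T2) (A : set T1) :
  {homo f : x y / (x <= y)%O} -> noetherian A -> noetherian (f @` A).
Proof.
move=> mf nA.
apply: noetherian_sub (noetherian_image2 (f := fun x _ => f x) _ nA nA).
  by move=> _ [x Ax <-]; exists x => //; exists x.
by move=> x y _ _ + _; exact: mf.
Qed.

(** * Families of subsets as sets of labelled elements *)

Section Labelled.
Context (d : Order.disp_t) (M : porderType d) (J : Type).

(* Distinct pairs with the same second component are incomparable, so that a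
   Noetherian set of pairs has finite fibres over [M]. *)
Definition labelled : Type := J * M.

HB.instance Definition _ := gen_eqMixin labelled.
HB.instance Definition _ := gen_choiceMixin labelled.

Implicit Types p q : labelled.

Definition labelled_lt p q := (p.2 < q.2)%O.

Lemma labelled_lt_irr : irreflexive labelled_lt.
Proof. by move=> p; exact: ltxx. Qed.

Lemma labelled_lt_trans : transitive labelled_lt.
Proof. by move=> q p r; exact: lt_trans. Qed.

HB.instance Definition _ := Order.Lt_isPOrder.Build d labelled
  labelled_lt_irr labelled_lt_trans.

Lemma labelled_ltE p q : (p < q)%O = (p.2 < q.2)%O.
Proof. by []. Qed.

Lemma labelled_leW p q : (p <= q)%O -> (p.2 <= q.2)%O.
Proof.
by rewrite [(p <= q)%O]le_eqVlt => /orP[/eqP->//|]; rewrite labelled_ltE => /ltW.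
Qed.

(** Pairs over a fixed [m] form an antichain, so all are minimal and hence finitely many.
    Conversely, minimal pairs lie over minimal elements of the projection, and fibres are finite. *)
Lemma noetherian_labelled (R : J -> set M) :
  noetherian [set p : labelled | R p.1 p.2] <->
  noetherian (\bigcup_j R j) /\ forall m, finite_set [set j | R j m].
Proof.
split=> [nR|[nR finR] X XR [p Xp]].
  split=> [|m].
    apply: noetherian_sub (noetherian_image labelled_leW nR) => m [j _ Rjm].
    by exists (j, m).
  pose X := [set p : labelled | R p.1 p.2 /\ p.2 = m].
  case: (pselect (X !=set0)) => [X0|X0]; last first.
    rewrite (_ : [set j | _] = set0)//; apply/seteqP; split=> // j Rjm.
    by apply: X0; exists (j, m).
  have [fin _] := nR X (fun p => @proj1 _ _) X0.
  apply: sub_finite_set (finite_image fst fin) => j Rjm.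
  exists (j, m) => //; split=> // q [_ qm].
  by rewrite labelled_ltE qm ltxx.
pose Y := snd @` X.
have YR : Y `<=` \bigcup_j R j by move=> _ [q /XR Rq <-]; exists q.1.
have [fin [_ [[q Xq <-] qmin]]] := nR Y YR (ex_intro _ _ (imageP _ Xp)).
split; last first.
  by exists q; split=> // r Xr; apply: (qmin r.2); exact: imageP.
apply: (@sub_finite_set _ _ (\bigcup_(m in minimal_elements Y)
    ((fun j => (j, m) : labelled) @` [set j | R j m]))); last first.
  by apply: bigcup_finite => // m _; exact: finite_image.
move=> r [Xr rmin]; exists r.2.
  by split; [exact: imageP | move=> _ [s Xs <-]; exact: rmin].
by exists r.1; [exact: XR | case: r {Xr rmin}].
Qed.

End Labelled.

(** * Products along trees of elements above 1 *)

Section OrderedUMagmaGt1.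
Context (d : Order.disp_t) (M : orderedUMagmaType d).
Implicit Types u v : M.

Lemma ltMl u v : (1%g < v)%O -> (u < u * v)%O%g.
Proof. by move=> v1; rewrite -{1}[u]mulg1; exact: ltmul2l. Qed.

Lemma ltMr u v : (1%g < u)%O -> (v < u * v)%O%g.
Proof. by move=> u1; rewrite -{1}[v]mul1g; exact: ltmul2r. Qed.

End OrderedUMagmaGt1.

Section TreeValues.
Context (d : Order.disp_t) (M : orderedUMagmaType d) (I : Type).
Variable R : I -> set M.

Fixpoint tree_values (t : na_tree I) : set M :=
  match t with
  | NaLeaf i => R i
  | NaNode s t => [set (u * v)%g | u in tree_values s & v in tree_values t]
  end.

Fixpoint tree_nodes (t : na_tree I) : nat :=
  if t is NaNode s t then (tree_nodes s + tree_nodes t).+1 else 0.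

Hypothesis R_gt1 : forall i m, R i m -> (1%g < m)%O.

Lemma tree_values_gt1 t m : tree_values t m -> (1%g < m)%O.
Proof.
elim: t m => [i m|s IHs t IHt m]; first exact: R_gt1.
move=> [u /IHs u1 [v /IHt v1 <-]]; exact: lt_trans u1 (ltMl _ v1).
Qed.

Lemma noetherian_tree_values :
  noetherian [set p : labelled M I | R p.1 p.2] ->
  noetherian [set p : labelled M (na_tree I) | tree_values p.1 p.2].
Proof.
move=> nR; apply: contrapT => nE.
have [x [Ex bad_x] nD] :=
  minimal_bad_seq (fun p : labelled M (na_tree I) => tree_nodes p.1) nE.
pose leaf (p : labelled M I) : labelled M (na_tree I) := (NaLeaf p.1, p.2).
pose node (p q : labelled M (na_tree I)) : labelled M (na_tree I) :=
  (NaNode p.1 q.1, (p.2 * q.2)%g).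
have leaf_homo : {homo leaf : p q / (p <= q)%O}.
  by move=> p q; rewrite le_eqVlt => /orP[/eqP->|pq]//; exact: ltW.
(* Labels matter only when both comparisons are equalities; one strict comparison already makes the
   products strictly comparable. *)
have node_homo p q r s : (p <= q)%O -> (r <= s)%O -> (node p r <= node q s)%O.
  rewrite [(p <= q)%O]le_eqVlt => /orP[/eqP->|pq].
    rewrite le_eqVlt => /orP[/eqP->|rs]//; apply: ltW; exact: ltmul2l.
  move=> /labelled_leW rs; apply: ltW.
  exact: lt_le_trans (ltmul2r _ _ _ pq) (lemul2 (lexx _) rs).
have [] := noetherian_good (x := x)
  (noetherianU (noetherian_image leaf_homo nR)
               (noetherian_image2 node_homo nD nD)).
  move=> n; case xn: (x n) (Ex n) => [[i|s t] m] /=.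
    by move=> Rim; left; exists (i, m).
  move=> [u su [v tv uvm]]; right.
  have u1 := tree_values_gt1 su; have v1 := tree_values_gt1 tv.
  exists (s, u); [split=> //|exists (t, v); [split=> //|by rewrite -uvm]].
    exists n; rewrite xn; first by rewrite /= ltnS leq_addr.
    by apply: ltW; rewrite -uvm; exact: ltMl.
  exists n; rewrite xn; first by rewrite /= ltnS leq_addl.
  by apply: ltW; rewrite -uvm; exact: ltMr.
by move=> i [j [ij]]; exact: bad_x.
Qed.

End TreeValues.

(** * Summability of the family of monomials *)

Section SummableFamilies.
Context (k : comPzRingType) (d : Order.disp_t) (M : orderedUMagmaType d).

Lemma hahn_gt1_summableZ (J : Type) (c : J -> k) (v : J -> hahn_gt1 k M) :
  hahn_gt1_summable v -> hahn_gt1_summable (fun j => c j *: v j).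
Proof.
have sub j : supp (val (c j *: v j)) `<=` supp (v j).
  move=> m; apply: contra_neq => /= vm.
  by rewrite -[LHS]/(c j * v j m) vm mulr0.
move=> [nv fv]; split=> [|m].
  by apply: noetherian_sub nv => m [j _ /sub vm]; exists j.
by apply: sub_finite_set (fv m) => j /sub.
Qed.

Lemma hahn_gt1_sum_at (J : Type) (v : J -> hahn_gt1 k M) (m : M)
    (F : set {classic J}) :
  hahn_gt1_summable v -> (forall j, v j m != 0 -> F j) ->
  hahn_gt1_sum v m = \sum_(j \in F) v j m.
Proof.
move=> sv vF; rewrite hahn_gt1_sumE// [LHS](congr1 (@^~ m) (hahn_sumE sv)).
symmetry; apply: fsbig_widen => // j [_ nFj].
by apply/eqP; apply: contra_notT nFj => /vF.
Qed.

End SummableFamilies.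

Section Monomials.
Context (k : comPzRingType) (d : Order.disp_t) (M : orderedUMagmaType d).
Variables (I : Type) (a : I -> hahn_gt1 k M).

Fixpoint monomial (t : na_tree I) : hahn_gt1 k M :=
  match t with
  | NaLeaf i => a i
  | NaNode s t => amul (monomial s) (monomial t)
  end.

(** Only an inclusion, since terms of a Cauchy product may cancel. *)
Lemma supp_monomial t :
  supp (monomial t) `<=` tree_values (fun i => supp (a i)) t.
Proof.
elim: t => [i m //|s IHs t IHt m /= /supp_cauchy[u /IHs ? [v /IHt ? <-]]].
by exists u => //; exists v.
Qed.

Hypothesis sa : hahn_gt1_summable a.

Lemma monomial_summable : hahn_gt1_summable monomial.
Proof.
apply/(noetherian_labelled (fun t => supp (monomial t))); apply: noetherian_sub.
  by move=> p; exact: supp_monomial.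
apply: noetherian_tree_values; first by move=> i m; exact: hahn_gt1_supp.
exact/(noetherian_labelled (fun i => supp (a i))).
Qed.

End Monomials.

(** * Coefficients of products of series without constant term *)

Section TreeCoefficients.
Context (k : comPzRingType) (I : Type).
Implicit Types P Q : na_series0 k I.

Definition tree_coef P (t : na_tree I) : k := val P (Some t).

Lemma na_series0_None P : val P None = 0.
Proof. by case: P => P /= /eqP. Qed.

(** The other decompositions of a node involve the empty word, where both series vanish. *)
Lemma tree_coef_mul_node P Q s t :
  tree_coef (amul P Q) (NaNode s t) = tree_coef P s * tree_coef Q t.
Proof.
rewrite -[LHS]/(cauchy (val P) (val Q) _) /cauchy.
transitivity (\sum_(p \in [set (Some s : na_word I, Some t : na_word I)])
    val P p.1 * val Q p.2); last by rewrite fsbig_set1.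
symmetry; apply: fsbig_widen => [_ ->//|[[u|] [v|]] [/= e ne]] /=.
- by case: ne; case: e => -> ->.
- by rewrite na_series0_None mulr0.
- by rewrite na_series0_None mul0r.
- by rewrite na_series0_None mul0r.
Qed.

Lemma tree_coef_mul_leaf P Q i : tree_coef (amul P Q) (NaLeaf i) = 0.
Proof.
by apply: fsbig1 => -[[u|] [v|]] //= _; rewrite !na_series0_None ?mulr0 ?mul0r.
Qed.

End TreeCoefficients.

(* Locked because unification otherwise unfolds [evaluation] when comparing its
   values at two series. *)
HB.lock Definition evaluation (k : comPzRingType) (d : Order.disp_t)
    (M : orderedUMagmaType d) (I : Type) (a : I -> hahn_gt1 k M)
    (P : na_series0 k I) : hahn_gt1 k M :=
  hahn_gt1_sum (fun t => tree_coef P t *: monomial a t).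

(** * The evaluation morphism *)

Section Evaluation.
Context (k : comPzRingType) (d : Order.disp_t) (M : orderedUMagmaType d).
Variables (I : Type) (a : I -> hahn_gt1 k M).
Hypothesis sa : hahn_gt1_summable a.

Local Notation evaluation := (evaluation a).
Local Notation monomial := (monomial a).

(** The free choice of [F] allows a finite set when sums are exchanged and [setT] when the sum is
    restricted to other trees. *)
Lemma evaluationE P m (F : set {classic (na_tree I)}) :
  (forall t, monomial t m != 0 -> F t) ->
  evaluation P m = \sum_(t \in F) tree_coef P t * monomial t m.
Proof.
move=> mF; rewrite evaluation.unlock; apply: hahn_gt1_sum_at => [|t tm].
  exact: hahn_gt1_summableZ (monomial_summable sa).
apply: mF; apply: contra_neq tm => e.
by rewrite -[LHS]/(tree_coef P t * monomial t m) e mulr0.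
Qed.

Let F m : set {classic (na_tree I)} := [set t | monomial t m != 0].

Let finF m : finite_set (F m).
Proof. exact: (monomial_summable sa).2. Qed.

Let evaluationF P m :
  evaluation P m = \sum_(t \in F m) tree_coef P t * monomial t m.
Proof. exact: evaluationE. Qed.

Lemma supp_evaluation P m : supp (evaluation P) m ->
  exists2 t, F m t & tree_coef P t != 0.
Proof.
rewrite /supp/= evaluationF.
move=> /(@fsbigN1 k 0 _ unit _ _ (fun _ (t : {classic (na_tree I)}) =>
  tree_coef P t * monomial t m) tt)[t Ft Pt].
by exists t => //; apply: contra_neq Pt => ->; rewrite mul0r.
Qed.

Lemma evaluation_linear : linear evaluation.
Proof.
move=> c P Q; do 2 apply/val_inj; apply/funext => m /=.
rewrite -[RHS]/(c * evaluation P m + evaluation Q m).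
rewrite (evaluationF P) (evaluationF Q) (evaluationF (c *: P + Q)).
rewrite -fsum_linear.
- by apply: eq_fsbigr => t _; rewrite mulrA -mulrDl.
- exact: finite_setIl.
- exact: finite_setIl.
Qed.

Lemma evaluation_strongly_linear : strongly_linear evaluation.
Proof.
split; first exact: evaluation_linear.
move=> J P sP.
have sev : hahn_gt1_summable (evaluation \o P).
  split=> [|m].
    apply: noetherian_sub (monomial_summable sa).1 => m.
    by move=> [j _ /supp_evaluation[t tm _]]; exists t.
  apply: (@sub_finite_set _ _
    (\bigcup_(t in F m) [set j | tree_coef (P j) t != 0])).
    by move=> j /supp_evaluation[t]; exists t.
  by apply: bigcup_finite => // t _; exact: sP.
split=> //; do 2 apply/val_inj; apply/funext => m /=.
(* Finitely many trees contribute at [m], each with nonzero coefficient in finitely many [P j]; so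
   the exchange of sums is finite. *)
pose G : set {classic J} :=
  \bigcup_(t in F m) [set j : {classic J} | tree_coef (P j) t != 0].
have finG : finite_set G by apply: bigcup_finite => // t _; exact: sP.
have evG j : evaluation (P j) m != 0 -> G j.
  apply: contra_neqP => nG; rewrite evaluationF.
  apply: fsbig1 => t Ft; rewrite (_ : tree_coef (P j) t = 0) ?mul0r//.
  by apply/eqP; apply: contra_notT nG => Pjt; exists t.
rewrite [LHS](hahn_gt1_sum_at sev evG) evaluationF.
under eq_fsbigr do rewrite /= evaluationF.
rewrite exchange_fsbig//; apply: eq_fsbigr => t; rewrite inE => Ft.
have -> : tree_coef (family_sum P) t = \sum_(j \in G) tree_coef (P j) t.
  symmetry; apply: fsbig_widen => // j [_ nG].
  by apply/eqP; apply: contra_notT nG => Pjt; exists t.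
by rewrite !fsbig_finite//= mulr_suml.
Qed.

Lemma evaluation_mul : amul_morphism evaluation.
Proof.
move=> P Q; do 2 apply/val_inj; apply/funext => m /=.
pose S := \bigcup_t supp (monomial t).
pose D := [set p : M * M | (p.1 * p.2)%g = m /\ S p.1 /\ S p.2].
have finD : finite_set D.
  by apply: noetherian_finite_decomp; exact: (monomial_summable sa).1.
(* The trees contributing at a factor of some decomposition in [D]: all sums below reduce to [D] and
   [G]. *)
pose G := \bigcup_(p in D) (F p.1 `|` F p.2).
have finG : finite_set G.
  by apply: bigcup_finite => // p _; rewrite finite_setU.
have cauchyD (f g : hahn_gt1 k M) : supp f `<=` S -> supp g `<=` S ->
    amul f g m = \sum_(p \in D) f p.1 * g p.2.
  move=> fS gS; symmetry; apply: fsbig_widen => [p []//|p [/= pm nD]].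
  apply/eqP; apply: contra_notT nD => fg; split=> //; split.
    by apply: fS; apply: contra_neq fg => ->; rewrite mul0r.
  by apply: gS; apply: contra_neq fg => ->; rewrite mulr0.
have monS t : supp (monomial t) `<=` S by move=> u tu; exists t.
have nodeD s t : monomial (NaNode s t) m =
    \sum_(p \in D) monomial s p.1 * monomial t p.2.
  exact: cauchyD (monS s) (monS t).
have evS R : supp (evaluation R) `<=` S.
  by move=> u /supp_evaluation[t tu _]; exists t.
pose node (q : {classic (na_tree I)} * {classic (na_tree I)}) :
  {classic (na_tree I)} := NaNode q.1 q.2.
have node_inj : set_inj (G `*` G) node by move=> [s t] [s' t'] _ _ [-> ->].
rewrite [RHS]cauchyD// (@evaluationE _ m setT)//.
(* The product has coefficient 0 at leaves, and the monomial of a node with a subtree outside [G]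
   vanishes at [m]. *)
rewrite -(@fsbig_widen _ _ _ _ (node @` (G `*` G)) setT)//; last first.
  move=> [i _|s t [_ nG]]; first by rewrite /= tree_coef_mul_leaf mul0r.
  suff st0 : monomial (NaNode s t) m = 0 by rewrite /= [X in _ * X]st0 mulr0.
  rewrite nodeD fsbig1// => p Dp.
  apply/eqP; apply: contra_notT nG => st; exists (s, t) => //; split.
    by exists p => //; left; apply: contra_neq st => /= ->; rewrite mul0r.
  by exists p => //; right; apply: contra_neq st => /= ->; rewrite mulr0.
rewrite fsbig_image//.
under eq_fsbigr do rewrite tree_coef_mul_node nodeD.
transitivity (\sum_(p \in D) \sum_(q \in G `*` G)
    tree_coef P q.1 * monomial q.1 p.1 * (tree_coef Q q.2 * monomial q.2 p.2)).
  have finGG : finite_set (G `*` G) by exact: finite_setX.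
  rewrite exchange_fsbig//; apply: eq_fsbigr => q _.
  rewrite !fsbig_finite// mulr_sumr; apply: eq_bigr => p _.
  by rewrite mulrACA.
(* For fixed [p] the double sum over [G] factors into the two evaluations at [p.1] and [p.2]. *)
apply: eq_fsbigr => p; rewrite inE => Dp.
rewrite (@evaluationE _ p.1 G); last by move=> t tp; exists p => //; left.
rewrite (@evaluationE _ p.2 G); last by move=> t tp; exists p => //; right.
rewrite -(@pair_fsbig _ _ _ _ _ G G (fun s t =>
  tree_coef P s * monomial s p.1 * (tree_coef Q t * monomial t p.2)))//.
rewrite !fsbig_finite// mulr_suml; apply: eq_bigr => s _.
by rewrite fsbig_finite// mulr_sumr.
Qed.

Lemma evaluation_X i : evaluation (na_X0 k i) = a i.
Proof.
do 2 apply/val_inj; apply/funext => m /=.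
rewrite (@evaluationE _ m setT)//.
transitivity (\sum_(t \in [set (NaLeaf i : {classic (na_tree I)})])
    tree_coef (na_X0 k i) t * monomial t m).
  symmetry; apply: fsbig_widen => // t [_ ti].
  suff tc0 : tree_coef (na_X0 k i) t = 0 by rewrite /= tc0 mul0r.
  rewrite /tree_coef /= /na_X (_ : (_ == _) = false)//.
  by apply/eqP => -[e]; apply: ti.
by rewrite fsbig_set1 /tree_coef /= /na_X eqxx mul1r.
Qed.

End Evaluation.

(* [iota] is the structure map of the rat-algebra [k]. *)
Theorem corollary3p31 (k : comPzRingType) (iota : {rmorphism rat -> k})
    (d : Order.disp_t) (M : orderedUMagmaType d) :
  has_evaluations (hahn_gt1 k M : sumAlgType k).
Proof.
move=> I a sa; exists (evaluation a); split.
- exact: evaluation_strongly_linear.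
- exact: evaluation_mul.
- exact: evaluation_X.
Qed.
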